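(* Let $G$ be a finite group, $K\le G$ a subgroup, $(\theta,V)$ an irreducible representation of $K$, and $v\in V$ with $\|v\|=1$. With $J$, $m_\sigma$, $U^\sigma_{i,j}$, $\widetilde U^\sigma_{i,j}$ and $T_v$ as defined in the context, for all $\sigma\in J$, $i,j=1,2,\ldots,m_\sigma$ and $f\in\mathrm{Ind}_K^GV$ we have $$T_vU^\sigma_{i,j}f=\widetilde U^\sigma_{i,j}T_vf,$$ that is, the square with horizontal maps $T_v:\mathrm{Ind}_K^GV\to T_v[\mathrm{Ind}_K^GV]$ and vertical maps $U^\sigma_{i,j}:\mathrm{Ind}_K^GV\to\mathrm{Ind}_K^GV$ and $\widetilde U^\sigma_{i,j}:T_v[\mathrm{Ind}_K^GV]\to T_v[\mathrm{Ind}_K^GV]$ is commutative.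
   Context: Scalar products are Hermitian and linear in the first argument; all representations are finite-dimensional, complex and unitary; $d_\sigma$ is the dimension of $\sigma$; $T^*$ is the adjoint of $T$. $\mathrm{Hom}(A,B)$ and its subspaces carry the scalar product $\langle T_1,T_2\rangle=\frac1{\dim A}\mathrm{tr}(T_2^*T_1)$; $\mathrm{Hom}_K$, $\mathrm{Hom}_G$ are spaces of intertwining operators. $L(G)$ is the space of functions $f:G\to\mathbb C$ with scalar product $\langle f_1,f_2\rangle=\sum_{g\in G}f_1(g)\overline{f_2(g)}$ and convolution $(f_1*f_2)(g)=\sum_{g_0\in G}f_1(gg_0^{-1})f_2(g_0)$. $\mathrm{Ind}_K^GV=\{f:G\to V: f(gk)=\theta(k^{-1})f(g)\ \forall g\in G,k\in K\}$ with $G$-action $[\lambda(g_0)f](g)=f(g_0^{-1}g)$ and scalar product $\langle f_1,f_2\rangle=\frac1{|K|}\sum_{g\in G}\langle f_1(g),f_2(g)\rangle_V$. The isometry $T_v:\mathrm{Ind}_K^GV\to L(G)$ is $(T_vf)(g)=\sqrt{d_\theta/|K|}\,\langle f(g),v\rangle$. For a $G$-representation $(\sigma,W)$ and $L\in\mathrm{Hom}_K(V,\mathrm{Res}^G_KW)$, $L^\diamond\in\mathrm{Hom}_G(\mathrm{Ind}_K^GV,W)$ is $L^\diamond f=\frac{1}{\sqrt{|G||K|}}\sum_{g\in G}\sigma(g)Lf(g)$. $\{(\sigma,W_\sigma):\sigma\in J\}$ is a complete set of pairwise inequivalent irreducible $G$-representations contained in $\mathrm{Ind}_K^GV$, $m_\sigma$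 is the multiplicity of $W_\sigma$ in $\mathrm{Ind}_K^GV$, and for every $\sigma\in J$ an orthonormal basis $\{L_{\sigma,1},\ldots,L_{\sigma,m_\sigma}\}$ of $\mathrm{Hom}_K(V,\mathrm{Res}^G_KW_\sigma)$ is fixed. Set $U^\sigma_{i,j}=\frac{d_\sigma}{d_\theta}(L_{\sigma,i}^\diamond)^*L_{\sigma,j}^\diamond$, $w^\sigma_i=L_{\sigma,i}v$, $u^\sigma_{i,j}(g)=\langle\sigma(g)w^\sigma_j,w^\sigma_i\rangle$, and $\widetilde U^\sigma_{i,j}f=\frac{d_\sigma}{|G|}f*\overline{u^\sigma_{j,i}}$ for $f\in L(G)$, where $\sigma\in J$ and $i,j=1,\ldots,m_\sigma$. *)

(* Defs.v *)
From HB Require Import structures.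
From mathcomp Require Import all_boot all_order all_fingroup all_algebra.
From mathcomp Require Import sesquilinear complex.
From mathcomp Require Import boolp classical_sets reals.

Set Implicit Arguments.
Unset Strict Implicit.
Unset Printing Implicit Defensive.

Import Order.TTheory GRing.Theory Num.Theory Num.Def.
Local Open Scope ring_scope.

Section ScalarProducts.
Variable C : numClosedFieldType.

Section Adjoint.
Variables (A B : vectType C).
Variables (dA : {dot A for conjC}) (dB : {dot B for conjC}).

(* The predicate has exactly one solution, see [adjointE] and
   [adjoint_unique]; the default value 0 is never used. *)
Definition adjoint (T : 'Hom(A, B)) : 'Hom(B, A) :=
  xget 0 [set S : 'Hom(B, A) | forall a b, dB (T a) b = dA a (S b)]%classic.

Let e := vbasis (fullv : {vspace A}).
Let Gram : 'M[C]_(\dim {:A}) := \matrix_(i, j) dA e`_i e`_j.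

Lemma Gram_unit : Gram \in unitmx.
Proof.
rewrite -row_free_unit; apply/row_freeP.
suff K0 : kermx Gram = 0.
  have /row_freeP[M MK] : row_free Gram by rewrite -kermx_eq0 K0.
  by exists M.
apply/eqP/rowV0P => u /sub_kermxP uG0.
set x := \sum_i u 0 i *: e`_i.
have xe (k : 'I_(\dim {:A})) : dA x e`_k = 0.
  have := congr1 (fun M : 'rV_ _ => M 0 k) uG0; rewrite !mxE => <-.
  rewrite /x linear_sumlz; apply: eq_bigr => i _.
  by rewrite linearZl_LR /= mxE.
have x0 : x = 0.
  apply/eqP; rewrite -(dnorm_eq0 dA) {2}/x linear_sum big1 // => i _.
  by rewrite linearZ_LR /= xe mulr0.
apply/rowP => i; rewrite mxE.
have /freeP := basis_free (vbasisP {:A}); apply; exact: x0.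
Qed.

Lemma adjoint_unique (S S' : 'Hom(B, A)) :
  (forall a b, dA a (S b) = dA a (S' b)) -> S = S'.
Proof.
move=> H; apply/lfunP => b; apply/eqP; rewrite -subr_eq0 -(dnorm_eq0 dA).
by rewrite linearB /= H subrr.
Qed.

Lemma adjointE (T : 'Hom(A, B)) a b : dB (T a) b = dA a (adjoint T b).
Proof.
have [S HS] : exists S : 'Hom(B, A), forall a b, dB (T a) b = dA a (S b).
  pose c (b : B) : 'rV[C]_(\dim {:A}) :=
    (\row_j (dB b (T e`_j))) *m invmx Gram.
  have clin : linear (fun b => \sum_i c b 0 i *: e`_i).
    move=> k x y; rewrite scaler_sumr -big_split /=; apply: eq_bigr => i _.
    rewrite scalerA -scalerDl; congr (_ *: _).
    have -> : c (k *: x + y) = k *: c x + c y.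
      rewrite /c scalemxAl -mulmxDl; congr (_ *m _); apply/rowP => j.
      by rewrite !mxE linearDl linearZl_LR.
    by rewrite !mxE.
  pose cL := GRing.isLinear.Build _ _ _ _ _ clin.
  pose S : {linear B -> A} := HB.pack (fun b => \sum_i c b 0 i *: e`_i) cL.
  exists (linfun S) => x y; rewrite lfunE /=.
  rewrite (coord_vbasis (memvf x)) linear_sum /= !linear_sumlz.
  apply: eq_bigr => k _; rewrite !linearZ /= !linearZl_LR /=; congr (_ * _).
  rewrite (hermC dB) (hermC dA) expr0 !mul1r; congr (_^*).
  rewrite linear_sumlz; under eq_bigr => i _ do rewrite linearZl_LR /=.
  transitivity ((\row_j dB y (T e`_j)) 0 k); first by rewrite mxE.
  rewrite -[\row_j _](mulmxKV Gram_unit) mxE.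
  by apply: eq_bigr => i _; rewrite [Gram i k]mxE.
have := @xgetPex _ 0
  [set S : 'Hom(B, A) | forall a b, dB (T a) b = dA a (S b)]%classic.
by move=> /(_ (ex_intro _ S HS)); apply.
Qed.

End Adjoint.

Section Hom.
Variables (A B : vectType C).
Variables (dA : {dot A for conjC}) (dB : {dot B for conjC}).

Definition lftrace (f : 'End(A)) : C :=
  \tr (passmx.mxof (vbasis {:A}) (vbasis {:A}) f).

Definition hom_dot (T1 T2 : 'Hom(A, B)) : C :=
  (\dim {:A})%:R^-1 * lftrace (adjoint dA dB T2 \o T1)%VF.

End Hom.

End ScalarProducts.

Section Representations.
Variables (C : numClosedFieldType) (gT : finGroupType).

(* Only the values of [rep_act] on D matter. *)
Record unitaryRep (D : {group gT}) := UnitaryRep {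
  rep_space :> vectType C;
  rep_dot : {dot rep_space for conjC};
  rep_act : gT -> 'End(rep_space);
  rep_act1 : rep_act 1%g = \1%VF;
  rep_actM : {in D &, forall g h,
    rep_act (g * h)%g = (rep_act g \o rep_act h)%VF};
  rep_unitary : {in D, forall g x y,
    rep_dot (rep_act g x) (rep_act g y) = rep_dot x y}
}.

Definition rep_norm D (rho : unitaryRep D) (x : rho) : C :=
  sqrtC (rep_dot rho x x).

Definition irreducible D (rho : unitaryRep D) : Prop :=
  {:rho}%VS != 0%VS /\
  forall U : {vspace rho}, {in D, forall g, (rep_act rho g @: U <= U)%VS} ->
    U = 0%VS \/ U = {:rho}%VS.

Section Restriction.
Variables (K G : {group gT}) (sKG : K \subset G) (rho : unitaryRep G).

Fact res_actM :
  {in K &, forall g h,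
    rep_act rho (g * h)%g = (rep_act rho g \o rep_act rho h)%VF}.
Proof.
move=> g h /(fintype.subsetP sKG) gG /(fintype.subsetP sKG) hG.
exact: rep_actM.
Qed.

Fact res_unitary : {in K, forall g x y,
  rep_dot rho (rep_act rho g x) (rep_act rho g y) = rep_dot rho x y}.
Proof. by move=> g /(fintype.subsetP sKG) gG; apply: rep_unitary. Qed.

Definition Res : unitaryRep K := UnitaryRep (rep_act1 rho) res_actM res_unitary.

End Restriction.

Section Intertwiners.
Variables (D : {group gT}) (rho sigma : unitaryRep D).

Definition intertwine_defect (g : gT) (T : 'Hom(rho, sigma)) :
    'Hom(rho, sigma) :=
  (T \o rep_act rho g)%VF - (rep_act sigma g \o T)%VF.

Fact intertwine_defect_linear g : linear (intertwine_defect g).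
Proof.
move=> a S T; apply/lfunP => x; rewrite /intertwine_defect.
by do !rewrite !lfunE /=; rewrite linearP scalerBr opprD addrACA.
Qed.
HB.instance Definition _ g := GRing.isSemilinear.Build C _ _ _
  (intertwine_defect g) (GRing.semilinear_linear (intertwine_defect_linear g)).

(* The space Hom_D(rho, sigma), see [intertwinersP]. *)
Definition intertwiners : {vspace 'Hom(rho, sigma)} :=
  (\bigcap_(g in D) lker (linfun (intertwine_defect g)))%VS.

Lemma intertwinersP (T : 'Hom(rho, sigma)) :
  reflect {in D, forall g, (T \o rep_act rho g)%VF = (rep_act sigma g \o T)%VF}
    (T \in intertwiners).
Proof.
rewrite memvE; apply: (iffP subv_bigcapP) => H g gD; move/(_ g gD): H.
  by rewrite -memvE memv_ker lfunE /= subr_eq0 => /eqP.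
by move=> H; rewrite -memvE memv_ker lfunE /= subr_eq0 H.
Qed.

Definition contained : Prop :=
  exists2 T : 'Hom(rho, sigma), T \in intertwiners & lker T == 0%VS.

Definition equivalent : Prop :=
  exists2 T : 'Hom(rho, sigma), T \in intertwiners &
    lker T == 0%VS /\ limg T = {:sigma}%VS.

End Intertwiners.

(* sigma has multiplicity m in rho: rho is the direct sum of irreducible
   subrepresentations (the images of the P k), exactly m of which are
   equivalent to sigma. *)
Definition has_multiplicity D (sigma rho : unitaryRep D) (m : nat) : Prop :=
  exists n (tau : 'I_n -> unitaryRep D) (P : forall k, 'Hom(tau k, rho))
      (A : {set 'I_n}),
    [/\ forall k, irreducible (tau k),
        forall k, P k \in intertwiners (tau k) rho /\ lker (P k) == 0%VS,
        directv (\sum_k limg (P k)) /\ (\sum_k limg (P k) = {:rho})%VS,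
        forall k, k \in A <-> equivalent (tau k) sigma
      & #|A| = m].

End Representations.

Section Induction.
Variables (C : numClosedFieldType) (G : finGroupType) (K : {group G}).
Variable theta : unitaryRep C K.

Definition ind_defect (g k : G) (f : {ffun G -> theta}) : theta :=
  f (g * k)%g - rep_act theta k^-1%g (f g).

Fact ind_defect_linear g k : linear (ind_defect g k).
Proof.
move=> a f1 f2; rewrite /ind_defect !ffunE linearP.
by rewrite scalerBr opprD addrACA.
Qed.
HB.instance Definition _ g k := GRing.isSemilinear.Build C _ _ _
  (ind_defect g k) (GRing.semilinear_linear (ind_defect_linear g k)).

(* The functions f with f(gk) = theta(k^-1) f(g), see [ind_spaceP]. *)
Definition ind_space : {vspace {ffun G -> theta}} :=
  (\bigcap_(g : G) \bigcap_(k in K) lker (linfun (ind_defect g k)))%VS.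

Lemma ind_spaceP (f : {ffun G -> theta}) :
  reflect (forall g, {in K, forall k,
             f (g * k)%g = rep_act theta k^-1%g (f g)})
    (f \in ind_space).
Proof.
rewrite memvE; apply: (iffP subv_bigcapP) => H g.
  move=> k kK; have /subv_bigcapP/(_ k kK) := H g isT.
  by rewrite -memvE memv_ker lfunE /= subr_eq0 => /eqP.
move=> _; apply/subv_bigcapP => k kK.
by rewrite -memvE memv_ker lfunE /= subr_eq0 H.
Qed.

Local Notation ind_type := (subvs_of ind_space).

Definition ind_dot (f1 f2 : ind_type) : C :=
  #|K|%:R^-1 * \sum_(g : G) rep_dot theta (vsval f1 g) (vsval f2 g).

Fact ind_dot_bilinear :
  bilinear_for *%R (conjC \; *%R : GRing.Scale.law C C) ind_dot.
Proof.
split=> f a f1 f2 /=; rewrite /ind_dot linearP /= mulrCA -mulrDr.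
  congr (_ * _); rewrite mulr_sumr -big_split; apply: eq_bigr => g _ /=.
  by rewrite !ffunE linearDl linearZl_LR.
congr (_ * _); rewrite mulr_sumr -big_split; apply: eq_bigr => g _ /=.
by rewrite !ffunE linearD linearZ.
Qed.

HB.instance Definition _ := bilinear_isBilinear.Build C _ _ C
  *%R (conjC \; *%R) ind_dot ind_dot_bilinear.

Fact ind_dot_hermitian f1 f2 :
  ind_dot f1 f2 = (-1) ^+ false * (ind_dot f2 f1)^*.
Proof.
rewrite expr0 mul1r /ind_dot rmorphM fmorphV rmorph_nat rmorph_sum /=.
by congr (_ * _); apply: eq_bigr => g _; rewrite hermC expr0 mul1r.
Qed.
HB.instance Definition _ := isHermitianSesquilinear.Build C ind_type
  false conjC ind_dot ind_dot_hermitian.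

Fact ind_dot_gt0 f : f != 0 -> 0 < ind_dot f f.
Proof.
move=> f_neq0; have ge0 g : 0 <= rep_dot theta (vsval f g) (vsval f g).
  exact: dnorm_ge0.
rewrite mulr_gt0 ?invr_gt0 ?ltr0n ?cardG_gt0 // lt_def sumr_ge0 // andbT.
apply: contra f_neq0 => /eqP/psumr_eq0P f0; apply/eqP/val_inj/ffunP => g.
by rewrite /= ffunE; apply/eqP; rewrite -(dnorm_eq0 (rep_dot theta)) f0.
Qed.
HB.instance Definition _ := isDotProduct.Build C ind_type ind_dot ind_dot_gt0.

(* [vsproj] is only meaningful on elements of [ind_space]; see [ind_actE]. *)
Definition ind_act (g0 : G) : 'End(ind_type) :=
  linfun (fun f : ind_type =>
    vsproj ind_space [ffun g => vsval f (g0^-1 * g)%g]).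

Lemma ind_actE g0 (f : ind_type) g :
  vsval (ind_act g0 f) g = vsval f (g0^-1 * g)%g.
Proof.
have lin : linear (fun f : ind_type =>
    vsproj ind_space [ffun g => vsval f (g0^-1 * g)%g]).
  move=> a f1 f2; rewrite -linearP; congr vsproj.
  by apply/ffunP => h; rewrite linearP !ffunE.
pose lL := GRing.isLinear.Build _ _ _ _ _ lin.
pose F : {linear ind_type -> ind_type} := HB.pack (fun f : ind_type =>
    vsproj ind_space [ffun g => vsval f (g0^-1 * g)%g]) lL.
rewrite /ind_act (lfunE F) /= vsprojK ?ffunE //.
apply/ind_spaceP => h k kK; rewrite !ffunE mulgA.
by have /ind_spaceP -> := subvsP f.
Qed.

Fact ind_act1 : ind_act 1%g = \1%VF.
Proof.
apply/lfunP => f; rewrite lfunE /=; apply/val_inj/ffunP => g /=.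
by rewrite ind_actE invg1 mul1g.
Qed.

Fact ind_actM : {in [set: G]%G &, forall g h,
  ind_act (g * h)%g = (ind_act g \o ind_act h)%VF}.
Proof.
move=> g h _ _; apply/lfunP => f; rewrite lfunE /=.
by apply/val_inj/ffunP => x /=; rewrite !ind_actE invMg mulgA.
Qed.

Fact ind_unitary : {in [set: G]%G, forall g f1 f2,
  ind_dot (ind_act g f1) (ind_act g f2) = ind_dot f1 f2}.
Proof.
move=> g _ f1 f2; rewrite /ind_dot; congr (_ * _).
rewrite [RHS](reindex_inj (mulgI g^-1%g)) /=.
by apply: eq_bigr => h _; rewrite !ind_actE.
Qed.

Definition Ind : unitaryRep C [set: G]%G :=
  @UnitaryRep C G [set: G]%G ind_type ind_dot ind_act
    ind_act1 ind_actM ind_unitary.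

Definition ind_fun (f : Ind) : {ffun G -> theta} := vsval (f : ind_type).

(* [linfun] is only meaningful on linear functions; see [diamondE]. *)
Definition diamond (sigma : unitaryRep C [set: G]%G)
    (L : 'Hom(theta, sigma)) : 'Hom(Ind, sigma) :=
  linfun (fun f : Ind => (sqrtC (#|[set: G]| * #|K|)%:R)^-1 *:
    \sum_(g : G) rep_act sigma g (L (ind_fun f g))).

Lemma diamondE (sigma : unitaryRep C [set: G]%G) (L : 'Hom(theta, sigma)) f :
  diamond L f = (sqrtC (#|[set: G]| * #|K|)%:R)^-1 *:
    \sum_(g : G) rep_act sigma g (L (ind_fun f g)).
Proof.
set c := (sqrtC _)^-1.
have lin : linear (fun f : Ind =>
    c *: \sum_(g : G) rep_act sigma g (L (ind_fun f g))).
  move=> a f1 f2.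
  have -> : ind_fun (a *: f1 + f2) = a *: ind_fun f1 + ind_fun f2.
    exact: (linearP (vsval : ind_type -> _)).
  rewrite scalerA mulrC -scalerA -scalerDr; congr (_ *: _).
  rewrite scaler_sumr -big_split; apply: eq_bigr => g _ /=.
  by rewrite !ffunE !linearP.
pose lL := GRing.isLinear.Build _ _ _ _ _ lin.
pose F : {linear Ind -> sigma} := HB.pack (fun f : Ind =>
    c *: \sum_(g : G) rep_act sigma g (L (ind_fun f g))) lL.
by rewrite /diamond (lfunE F).
Qed.

Definition Tmap (v : theta) (f : Ind) : {ffun G -> C} :=
  [ffun g => sqrtC ((\dim {:theta})%:R / #|K|%:R)
             * rep_dot theta (ind_fun f g) v].

Variable J : Type.
Variable sigma : J -> unitaryRep C [set: G]%G.
Variable m : J -> nat.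
Variable L : forall s : J, 'I_(m s) -> 'Hom(theta, sigma s).
Variable v : theta.
Implicit Types s : J.

Definition Umap s (i j : 'I_(m s)) : 'End(Ind) :=
  ((\dim {:sigma s})%:R / (\dim {:theta})%:R) *:
    (adjoint (rep_dot Ind) (rep_dot (sigma s)) (diamond (L i))
       \o diamond (L j))%VF.

Definition wvec s (i : 'I_(m s)) : sigma s := L i v.

Definition ufun s (i j : 'I_(m s)) : {ffun G -> C} :=
  [ffun g => rep_dot (sigma s) (rep_act (sigma s) g (wvec j)) (wvec i)].

Definition convolution (f1 f2 : {ffun G -> C}) : {ffun G -> C} :=
  [ffun g => \sum_(g0 : G) f1 (g * g0^-1)%g * f2 g0].

Definition Utilde s (i j : 'I_(m s)) (f : {ffun G -> C}) : {ffun G -> C} :=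
  [ffun g => (\dim {:sigma s})%:R / #|[set: G]|%:R
             * convolution f [ffun h => (ufun j i h)^*] g].

End Induction.

Section Data.
Variables (C : numClosedFieldType) (G : finGroupType) (K : {group G}).
Variables (theta : unitaryRep C K) (J : Type).
Variable sigma : J -> unitaryRep C [set: G]%G.

Definition complete_irreducibles : Prop :=
  [/\ forall s, irreducible (sigma s),
      forall s, contained (sigma s) (Ind theta),
      forall s t, equivalent (sigma s) (sigma t) -> s = t
    & forall rho : unitaryRep C [set: G]%G,
        irreducible rho -> contained rho (Ind theta) ->
        exists s, equivalent rho (sigma s)].

Definition orthonormal_basis_HomK s m
    (L : 'I_m -> 'Hom(theta, sigma s)) : Prop :=
  basis_of (intertwiners theta (Res (finset.subsetT K) (sigma s)))
    [seq L i | i : 'I_m] /\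
  forall i j, hom_dot (rep_dot theta) (rep_dot (sigma s)) (L i) (L j)
              = (i == j)%:R.

End Data.

(* Main.v *)
(* With [c = sqrt (d_theta / |K|)], both sides at [g] are [c d_sigma / |G|] times
   a sum over [h] in [G], of [d_theta^-1 <sigma(g^-1 h) L_j f(h), L_i v>] on the
   left and of [<f(h), v> <sigma(g^-1 h) L_j v, L_i v>] on the right.
   Translating [h] by [k] in [K] fixes the left summand; averaging the right one
   over [k] replaces [<f(h), v> v] by the mean over [K] of
   [<x, theta(k) v> theta(k) v] with [x = f(h)], which is [d_theta^-1 x] by
   Schur's lemma. *)
Require Import Defs.
From HB Require Import structures.
From mathcomp Require Import all_boot all_order all_fingroup all_algebra.
From mathcomp Require Import sesquilinear complex reals.
From mathcomp Require Import spectral.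

Set Implicit Arguments.
Unset Strict Implicit.
Unset Printing Implicit Defensive.

Import Order.TTheory GRing.Theory Num.Theory.
Local Open Scope ring_scope.

Section ScalarProduct.
Variables (C : numClosedFieldType) (A : vectType C).
Variable dA : {dot A for Num.conj}.

Lemma dotC x y : dA x y = (dA y x)^*.
Proof. by rewrite hermC expr0 mul1r. Qed.

Lemma dot_nondegenerate x y : (forall z, dA z x = dA z y) -> x = y.
Proof.
move=> xy; apply/eqP; rewrite -subr_eq0 -(dnorm_eq0 dA).
by rewrite linearB /= xy subrr.
Qed.

(** The left side is the trace of the rank-one operator [x |-> <x, w> w], written in coordinates
    because [vbasis] need not be orthonormal. *)
Lemma trace_rank_one (w : A) :
  \sum_i coord (vbasis {:A}) i (dA (vbasis {:A})`_i w *: w) = dA w w.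
Proof.
rewrite [in RHS](coord_vbasis (memvf w)) linear_sumlz.
apply: eq_bigr => i _.
by rewrite linearZ linearZl_LR -(coord_vbasis (memvf w)) /= mulrC.
Qed.

Lemma trace_scale (a : C) :
  \sum_i coord (vbasis {:A}) i (a *: (vbasis {:A})`_i) = a * (\dim {:A})%:R.
Proof.
transitivity (\sum_(i < \dim {:A}) a); last by rewrite sumr_const card_ord mulr_natr.
apply: eq_bigr => i _.
by rewrite linearZ /= coord_free ?(basis_free (vbasisP _)) // eqxx mulr1.
Qed.

Lemma memv_leigenspace (T : 'End(A)) a x :
  (x \in passmx.leigenspace T a) = (T x == a *: x).
Proof. by rewrite memv_ker add_lfunE opp_lfunE scale_lfunE id_lfunE subr_eq0. Qed.

(** [C] is algebraically closed and the matrix of [T] has positive size, so the matrix has an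
    eigenvalue, which passes back to [T] through the basis. *)
Lemma exists_leigenvalue (T : 'End(A)) :
  {:A}%VS != 0%VS -> exists a, passmx.leigenvalue T a.
Proof.
rewrite -dimv_eq0 -lt0n => dim_gt0.
have [a aT] :=
  eigenvalue_closed (passmx.mxof (vbasis {:A}) (vbasis {:A}) T) dim_gt0.
exists a; rewrite /passmx.leigenvalue (passmx.leigenspaceE (vbasisP _)).
by rewrite passmx.vsof_eq0 ?vbasisP.
Qed.

End ScalarProduct.

Section UnitaryRepresentations.
Variables (C : numClosedFieldType) (gT : finGroupType) (D : {group gT}).
Implicit Types rho sigma : unitaryRep C D.

Lemma rep_actMx rho : {in D &, forall g h x,
  rep_act rho (g * h)%g x = rep_act rho g (rep_act rho h x)}.
Proof. by move=> g h gD hD x; rewrite rep_actM ?lfunE. Qed.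

Lemma rep_dot_actl rho : {in D, forall g x y,
  rep_dot rho (rep_act rho g x) y = rep_dot rho x (rep_act rho g^-1%g y)}.
Proof.
move=> g gD x y; rewrite -(rep_unitary (groupVr gD)) -rep_actMx ?groupV //.
by rewrite mulVg rep_act1 lfunE.
Qed.

(** An eigenspace of [T] is stable under [D] because [T] commutes with the action; being nonzero, it
    is the whole space by irreducibility. *)
Lemma Schur_scalar rho (T : 'End(rho)) :
  irreducible rho -> T \in intertwiners rho rho -> exists a, T = a *: \1%VF.
Proof.
move=> [rho_neq0 rho_irr] /intertwinersP TD.
have [a] := exists_leigenvalue T rho_neq0; rewrite /passmx.leigenvalue => Ea.
have E_stable : {in D, forall g,
    (rep_act rho g @: passmx.leigenspace T a <= passmx.leigenspace T a)%VS}.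
  move=> g gD; apply/subvP => _ /memv_imgP[x xE ->]; move: xE.
  rewrite !memv_leigenspace => /eqP Tx.
  have /lfunP/(_ x) := TD g gD; rewrite !lfunE /= => ->.
  by rewrite Tx linearZ.
exists a; have [E0|ET] := rho_irr _ E_stable; first by rewrite E0 eqxx in Ea.
apply/lfunP => x; have := memvf x; rewrite -ET memv_leigenspace => /eqP ->.
by rewrite !lfunE /= lfunE.
Qed.

(** As an operator in [x], the left side commutes with [D]; it is a scalar by Schur's lemma, and its
    trace determines that scalar. *)
Lemma orbit_frame rho (v x : rho) : irreducible rho ->
  \sum_(k in D) rep_dot rho x (rep_act rho k v) *: rep_act rho k v
  = (#|D|%:R * rep_dot rho v v / (\dim {:rho})%:R) *: x.
Proof.
move=> rho_irr.
pose S (y : rho) : rho :=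
  \sum_(k in D) rep_dot rho y (rep_act rho k v) *: rep_act rho k v.
have S_lin : linear S.
  move=> a y z; rewrite /S scaler_sumr -big_split; apply: eq_bigr => k _ /=.
  by rewrite linearDl linearZl_LR /= scalerDl scalerA.
pose S_isLinear := GRing.isLinear.Build _ _ _ _ _ S_lin.
pose SL : {linear rho -> rho} := HB.pack S S_isLinear.
have /(Schur_scalar rho_irr)[a Sa] : linfun SL \in intertwiners rho rho.
  apply/intertwinersP => g gD; apply/lfunP => y.
  rewrite !comp_lfunE !(lfunE SL) /=.
  (* After [k] is replaced by [g * k], unitarity removes [g] from the coefficients and only the
     vectors keep it. *)
  rewrite /S (reindex_inj (mulgI g)) linear_sum /=.
  apply: eq_big => k; first by rewrite groupMl.
  rewrite groupMl // => kD.
  by rewrite rep_actMx // linearZ rep_unitary.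
have {}Sa y : S y = a *: y by rewrite -[LHS](lfunE SL) Sa !lfunE /= lfunE.
have dim_neq0 : (\dim {:rho})%:R != 0 :> C.
  by rewrite pnatr_eq0 dimv_eq0; case: rho_irr.
(* The trace of [S] is computed twice: as that of the scalar [a], and as a sum of [#|D|] rank-one
   traces, each equal to [<v, v>]. *)
have traceS : a * (\dim {:rho})%:R = #|D|%:R * rep_dot rho v v.
  rewrite -trace_scale; under eq_bigr => i _ do rewrite -Sa linear_sum /=.
  rewrite exchange_big /= mulr_natl -sumr_const; apply: eq_bigr => k kD.
  by rewrite trace_rank_one rep_unitary.
by rewrite -traceS mulfK // -Sa.
Qed.

(** Taking adjoints in the relation for [T] at [g^-1] gives the relation at [g], since by unitarity
    [g] acts as the adjoint of [g^-1]. *)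
Lemma adjoint_intertwiner rho sigma (T : 'Hom(rho, sigma)) :
  T \in intertwiners rho sigma ->
  adjoint (rep_dot rho) (rep_dot sigma) T \in intertwiners sigma rho.
Proof.
move=> /intertwinersP TD; apply/intertwinersP => g gD; apply/lfunP => y.
rewrite !lfunE /=; apply: (@dot_nondegenerate _ _ (rep_dot rho)) => z.
have gVD : g^-1%g \in D by rewrite groupV.
rewrite -adjointE -[in LHS](invgK g) -rep_dot_actl //.
have /lfunP/(_ z) := TD _ gVD; rewrite !lfunE /= => <-.
by rewrite (adjointE (rep_dot rho)) rep_dot_actl // invgK.
Qed.

End UnitaryRepresentations.

Section Induction.
Variables (C : numClosedFieldType) (G : finGroupType) (K : {group G}).
Variables (theta : unitaryRep C K) (sigma : unitaryRep C [set: G]%G).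
Local Notation HomK :=
  (intertwiners theta (Res (finset.subsetT K) sigma)).

(** The right side, as a function of [g], lies in the induced space and pairs with every [f] as the
    adjoint must. Its factor [#|K|] cancels the [1 / |K|] in the scalar product of [Ind theta]. *)
Lemma adjoint_diamondE (L : 'Hom(theta, sigma)) (w : sigma) (g : G) :
  L \in HomK ->
  ind_fun (adjoint (rep_dot (Ind theta)) (rep_dot sigma) (diamond L) w) g
  = (#|K|%:R / sqrtC (#|[set: G]| * #|K|)%:R) *:
      adjoint (rep_dot theta) (rep_dot sigma) L (rep_act sigma g^-1%g w).
Proof.
move=> LK; set c := sqrtC _; set Ladj := adjoint _ _ L.
have LadjK : Ladj \in intertwiners (Res (finset.subsetT K) sigma) theta.
  exact: (adjoint_intertwiner LK).
pose F := [ffun h => (#|K|%:R / c) *: Ladj (rep_act sigma h^-1%g w)].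
have FI : F \in ind_space theta.
  apply/ind_spaceP => h k kK; rewrite !ffunE linearZ /= invMg.
  rewrite rep_actMx ?inE //; congr (_ *: _).
  have /intertwinersP/(_ k^-1%g) := LadjK; rewrite groupV => /(_ kK).
  by move=> /lfunP/(_ (rep_act sigma h^-1%g w)); rewrite !lfunE.
suff -> : adjoint (rep_dot (Ind theta)) (rep_dot sigma) (diamond L) w
    = vsproj (ind_space theta) F by rewrite /ind_fun vsprojK // ffunE.
apply: (@dot_nondegenerate _ _ (rep_dot (Ind theta))) => f.
rewrite -adjointE diamondE linearZl_LR linear_sumlz /= /ind_dot vsprojK //.
rewrite !mulr_sumr; apply: eq_bigr => h _; rewrite ffunE linearZ /=.
rewrite rep_dot_actl ?inE // (adjointE (rep_dot theta)) mulrA; congr (_ * _).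
have cR : c^* = c by apply/CrealP; rewrite ger0_real // sqrtC_ge0 ler0n.
rewrite -/c rmorphM fmorphV rmorph_nat /= cR mulrA mulVf ?mul1r //.
by rewrite pnatr_eq0 -lt0n cardG_gt0.
Qed.

Lemma adjoint_diamond_comp (L1 L2 : 'Hom(theta, sigma)) (f : Ind theta) v g :
  L1 \in HomK ->
  rep_dot theta (ind_fun (adjoint (rep_dot (Ind theta)) (rep_dot sigma)
                            (diamond L1) (diamond L2 f)) g) v
  = #|[set: G]|%:R^-1 * \sum_(h : G)
      rep_dot sigma (rep_act sigma (g^-1 * h)%g (L2 (ind_fun f h))) (L1 v).
Proof.
move=> L1K; rewrite adjoint_diamondE // linearZl_LR /= [X in _ * X]dotC.
rewrite -adjointE -dotC diamondE linearZ /= linearZl_LR /= mulrA.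
have G0 : #|[set: G]|%:R != 0 :> C by rewrite pnatr_eq0 -lt0n cardG_gt0.
have K0 : #|K|%:R != 0 :> C by rewrite pnatr_eq0 -lt0n cardG_gt0.
congr (_ * _).
  (* The two square roots multiply to [|G||K|], and [|K|] cancels. *)
  by rewrite -mulrA -invfM -expr2 sqrtCK natrM invfM mulrCA mulfV ?mulr1.
rewrite linear_sum linear_sumlz; apply: eq_bigr => h _.
by rewrite rep_actMx ?inE.
Qed.

Lemma sum_translation_average (F : G -> C) :
  #|K|%:R * \sum_(h : G) F h = \sum_(h : G) \sum_(k in K) F (h * k)%g.
Proof.
rewrite exchange_big /= mulr_natl -sumr_const; apply: eq_bigr => k _.
by rewrite [LHS](reindex_inj (mulIg k)).
Qed.

Lemma ind_orthogonality (L1 L2 : 'Hom(theta, sigma)) (f : Ind theta) v g :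
  irreducible theta -> rep_dot theta v v = 1 -> L2 \in HomK ->
  (\dim {:theta})%:R^-1 * (\sum_(h : G)
      rep_dot sigma (rep_act sigma (g^-1 * h)%g (L2 (ind_fun f h))) (L1 v))
  = \sum_(h : G) rep_dot theta (ind_fun f h) v
      * rep_dot sigma (rep_act sigma (g^-1 * h)%g (L2 v)) (L1 v).
Proof.
move=> theta_irr v1 /intertwinersP L2K.
have K0 : #|K|%:R != 0 :> C by rewrite pnatr_eq0 -lt0n cardG_gt0.
(* Only the right-hand sum is averaged over [K]; the two sides then agree for each [h]
   separately. *)
apply: (mulfI K0); rewrite sum_translation_average mulrA mulr_sumr.
apply: eq_bigr => h _.
have := orbit_frame v (ind_fun f h) theta_irr; rewrite v1 mulr1 => frame.
transitivity (rep_dot sigma (rep_act sigma (g^-1 * h)%g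
    (L2 ((#|K|%:R / (\dim {:theta})%:R) *: ind_fun f h))) (L1 v)).
  by rewrite !linearZ /= linearZl_LR.
(* The terms at [k] match: [<f(hk), v> = <f(h), theta(k) v>] by covariance of [f] and unitarity, and
   [L2] intertwines the actions of [k]. *)
rewrite -frame !linear_sum linear_sumlz; apply: eq_bigr => k kK.
rewrite !linearZ /= linearZl_LR /= mulgA !rep_actMx ?inE //.
have /ind_spaceP-> // : ind_fun f \in ind_space theta by exact: subvsP.
rewrite (@rep_dot_actl _ _ _ theta) ?groupV // invgK.
by have /lfunP/(_ v) := L2K k kK; rewrite !lfunE /= => ->.
Qed.

End Induction.

Theorem theorem5p5 (R : realType) (G : finGroupType) (K : {group G})
    (theta : unitaryRep R[i] K) (theta_irr : irreducible theta)
    (v : theta) (v_norm : rep_norm v = 1)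
    (J : Type) (sigma : J -> unitaryRep R[i] [set: G]%G)
    (sigma_complete : complete_irreducibles theta sigma)
    (m : J -> nat)
    (m_mult : forall s, has_multiplicity (sigma s) (Ind theta) (m s))
    (L : forall s, 'I_(m s) -> 'Hom(theta, sigma s))
    (L_basis : forall s, orthonormal_basis_HomK (L s))
    (s : J) (i j : 'I_(m s)) (f : Ind theta) :
  Tmap v (Umap L i j f) = Utilde L v i j (Tmap v f).
Proof.
have v1 : rep_dot theta v v = 1 by rewrite -[LHS]sqrtCK [sqrtC _]v_norm expr1n.
have LK l : L s l \in intertwiners theta (Res (finset.subsetT K) (sigma s)).
  have [Lb _] := L_basis s.
  by apply: (basis_mem Lb); apply: map_f; rewrite mem_enum.
apply/ffunP => g; rewrite !ffunE.
have -> : ind_fun (Umap L i j f) g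
    = ((\dim {:sigma s})%:R / (\dim {:theta})%:R) *:
       ind_fun (adjoint (rep_dot (Ind theta)) (rep_dot (sigma s))
                 (diamond (L s i)) (diamond (L s j) f)) g.
  by rewrite /Umap scale_lfunE comp_lfunE /ind_fun linearZ /= ffunE.
rewrite linearZl_LR /= adjoint_diamond_comp //.
set c := sqrtC _; set X := \sum_h _.
(* The factor [1 / d_theta] of [Umap] is set next to [X], where [ind_orthogonality] absorbs it. *)
transitivity (c * (\dim {:sigma s})%:R / #|[set: G]|%:R
              * ((\dim {:theta})%:R^-1 * X)).
  by rewrite -!mulrA; congr (_ * (_ * _)); rewrite mulrCA.
rewrite /X ind_orthogonality // -!mulrA [LHS]mulrCA; congr (_ * _).
rewrite [LHS]mulrCA; congr (_ * _).
(* Substituting [g * h^-1] for [h] produces the argument of the first convolution factor and turns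
   [g^-1 * h] into [h^-1]. *)
rewrite mulr_sumr [LHS](reindex_inj (inj_comp (mulgI g) invg_inj)) /=.
apply: eq_bigr => h _; rewrite !ffunE mulrA mulKg; congr (_ * _).
(* The conjugate of [ufun j i] at [h] is [<w_j, sigma(h) w_i> = <sigma(h^-1) w_j, w_i>], which
   explains the swapped indices in [Utilde]. *)
by rewrite -dotC [LHS]rep_dot_actl ?inE // invgK.
Qed.
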